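(* Let $A$ be a finite set, $n\ge 1$, and let $R\subseteq A^n$ be a subdirect, irredundant, proper relation. Then at least one of the following holds: (1) $R$ pp-defines a relation $R'\subseteq A^2$ which is subdirect, irredundant and proper; or (2) there exist ternary relations $R_1,\dots,R_m\subseteq A^3$, each subdirect and strongly functional, such that the set $\{R_1,\dots,R_m\}$ is inter-pp-definable with $R$, i.e., $\{R_1,\dots,R_m\}$ pp-defines $R$ and $R$ pp-defines each $R_i$.
   Context: A relation $R\subseteq A^n$ is subdirect if its projection onto every coordinate is all of $A$; proper if $R\neq A^n$; irredundant if there are no two distinct coordinates $i\neq j$ such that the projection of $R$ onto coordinates $i,j$ is the graph of a bijection $A\to A$. A set of relations $\mathcal R$ on $A$ pp-defines a relation $S$ if $S$ is definable by a primitive positive formula (existential quantification of a conjunction of atomic formulas) using relations from $\mathcal R$, the equality relation, and the singleton unary relations $\{a\}$, $a\in A$ (i.e., parameters are allowed). A ternary relation $T\subseteq A^3$ is strongly functional if its projection onto every pair of coordinates equals $A^2$ and every tuple of $T$ is uniquely determined by its values on any two coordinates. *)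

(* Defs.v *)
From mathcomp Require Import all_boot.

Set Implicit Arguments.
Unset Strict Implicit.
Unset Printing Implicit Defensive.

(* A k-ary relation on A is a set of k-tuples over A. *)

Section Relations.
Variables (A : finType) (k : nat).
Implicit Types (R : {set k.-tuple A}) (i j : 'I_k).

Definition proj R i : {set A} := [set tnth t i | t in R].

Definition proj2 R i j : {set A * A} := [set (tnth t i, tnth t j) | t in R].

Definition subdirect R := forall i, proj R i = [set: A].

Definition proper_rel R := R <> [set: k.-tuple A].

Definition is_bij_graph (B : {set A * A}) :=
  exists2 f : A -> A, bijective f & B = [set (x, f x) | x : A].

Definition irredundant R :=
  ~ exists i j, i <> j /\ is_bij_graph (proj2 R i j).

End Relations.

Definition strongly_functional (A : finType) (T : {set 3.-tuple A}) :=
  forall i j : 'I_3, i <> j ->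
    proj2 T i j = [set: A * A] /\
    (forall s t, s \in T -> t \in T ->
       tnth s i = tnth t i -> tnth s j = tnth t j -> s = t).

(* Relations of arbitrary arity, so that a set of relations on A may mix
   arities. *)
Definition relation (A : finType) := {k : nat & {set k.-tuple A}}.

Definition Rel (A : finType) (k : nat) (R : {set k.-tuple A}) : relation A :=
  Tagged (fun k => {set k.-tuple A}) R.

Section PPFormulas.
Variable A : finType.

(* Atoms with variables in V; AtConst a x is the atom x \in {a}. *)
Inductive atom (V : Type) :=
| AtRel (Q : relation A) of (tag Q).-tuple V
| AtEq of V & V
| AtConst of A & V.

Definition atom_over V (Gamma : {pred relation A}) (p : atom V) : bool :=
  if p is AtRel Q _ then Q \in Gamma else true.

Definition atom_holds V (e : V -> A) (p : atom V) : bool :=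
  match p with
  | AtRel Q x => map_tuple e x \in tagged Q
  | AtEq x y => e x == e y
  | AtConst a x => e x == a
  end.

(* inl i is the i-th free variable, inr j the j-th existentially quantified
   one. *)
Record pp_formula (k : nat) := PPFormula {
  pp_bound : nat;
  pp_atoms : seq (atom ('I_k + 'I_pp_bound))
}.

Definition valuation k q (t : k.-tuple A) (w : q.-tuple A)
    (v : 'I_k + 'I_q) : A :=
  match v with inl i => tnth t i | inr j => tnth w j end.

Definition pp_sat k (phi : pp_formula k) (t : k.-tuple A) : bool :=
  [exists w : (pp_bound phi).-tuple A,
     all (atom_holds (valuation t w)) (pp_atoms phi)].

Definition pp_defines (Gamma : {pred relation A}) k (S : {set k.-tuple A}) :=
  exists phi : pp_formula k,
    all (atom_over Gamma) (pp_atoms phi) /\ S = [set t | pp_sat phi t].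

End PPFormulas.

(* Main.v *)
Require Import Defs.
From mathcomp Require Import all_boot.
From mathcomp Require Import boolp.

(* If (1) fails, every pp-definable binary relation that is subdirect is full or
   the graph of a bijection.  Fixing one coordinate, every pp-definable ternary
   relation whose binary projections are full is full or strongly functional.

   Let I be maximal such that R projects onto A^I.  For j outside I consider the
   projection S(x, y) of R to I and j.  By induction on the number of variables,
   such an S is either full, which contradicts the maximality of I, or the graph
   of a function definable from strongly functional ternary relations: if no
   two variables already determine y, split off a variable z = x_i and write
     S(x, z, u)  <->  exists v, S(x, a, v) /\ P(v, z, u),
   where P(v, z, u) := exists x, S(x, z, u) /\ S(x, a, v) is not full because
   P(v, a, u) forces v = u.  Finally R is the conjunction of these graphs. *)

Set Implicit Arguments.
Unset Strict Implicit.
Unset Printing Implicit Defensive.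

(** * Closure properties of pp-definability *)

Section PPDefinability.
Variable A : finType.
Implicit Types (Gamma : {pred relation A}) (V W U : Type).

Definition join V W (e : V -> A) (w : W -> A) (x : V + W) : A :=
  match x with inl v => e v | inr u => w u end.

Definition atom_map V W (f : V -> W) (p : atom A V) : atom A W :=
  match p with
  | AtRel Q x => AtRel (map_tuple f x)
  | AtEq x y => AtEq A (f x) (f y)
  | AtConst a x => AtConst a (f x)
  end.

Lemma atom_over_map Gamma V W (f : V -> W) s :
  all (atom_over Gamma) (map (atom_map f) s) = all (atom_over Gamma) s.
Proof. by elim: s => //= p s ->; case: p. Qed.

Lemma atoms_hold_map V W (f : V -> W) (e : W -> A) s :
  all (atom_holds e) (map (atom_map f) s) = all (atom_holds (e \o f)) s.
Proof.
elim: s => //= p s ->; congr (_ && _); case: p => //= Q x.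
suff -> : map_tuple e (map_tuple f x) = map_tuple (e \o f) x by [].
by apply: eq_from_tnth => i; rewrite !tnth_map.
Qed.

(* Semantic pp-definability with arbitrary types of variables, which makes the
   closure properties free of index arithmetic. *)
Definition ppd Gamma V (P : (V -> A) -> Prop) :=
  exists (W : finType) (s : seq (atom A (V + W))),
    all (atom_over Gamma) s /\
    forall e, P e <-> exists w : W -> A, all (atom_holds (join e w)) s.

Lemma ppd_ext Gamma V (P Q : (V -> A) -> Prop) :
  (forall e, P e <-> Q e) -> ppd Gamma P -> ppd Gamma Q.
Proof.
move=> PQ [W [s [sG Ps]]]; exists W, s; split=> // e.
by rewrite -PQ; apply: Ps.
Qed.

Lemma ppd_subst Gamma V W (f : V -> W) (P : (V -> A) -> Prop) :
  ppd Gamma P -> ppd Gamma (fun e => P (e \o f)).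
Proof.
move=> [U [s [sG Ps]]].
pose g (x : V + U) := match x with inl v => inl (f v) | inr u => inr u end.
exists U, (map (atom_map g) s); split; first by rewrite atom_over_map.
move=> e; rewrite Ps; have jE w : join e w \o g = join (e \o f) w.
  by apply: funext => -[].
by split=> -[w sw]; exists w; move: sw; rewrite atoms_hold_map jE.
Qed.

Lemma ppd_true Gamma V : ppd Gamma (fun _ : V -> A => True).
Proof.
by exists void, [::]; split=> // e; split=> // _; exists (of_void A).
Qed.

Lemma ppd_const Gamma V (a : A) (v : V) : ppd Gamma (fun e => e v = a).
Proof.
exists void, [:: AtConst a (inl v)]; split=> // e; split=> [ea|[w]].
  by exists (of_void A); rewrite /= ea eqxx.
by rewrite /= andbT => /eqP.
Qed.

Lemma ppd_rel Gamma k (T : {set k.-tuple A}) :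
  Rel T \in Gamma -> ppd Gamma (fun e : 'I_k -> A => mktuple e \in T).
Proof.
move=> TG; exists void, [:: @AtRel A _ (Rel T) (mktuple inl)].
split=> [|e]; first by rewrite /= TG.
have tE w : map_tuple (join e w) (mktuple (@inl _ void)) = mktuple e.
  by apply: eq_from_tnth => i; rewrite tnth_map !tnth_mktuple.
split=> [eT|[w]]; last by rewrite /= andbT tE.
by exists (of_void A); rewrite /= andbT tE.
Qed.

Lemma ppd_and Gamma V (P Q : (V -> A) -> Prop) :
  ppd Gamma P -> ppd Gamma Q -> ppd Gamma (fun e => P e /\ Q e).
Proof.
move=> [U [s [sG Ps]]] [W [r [rG Qr]]].
pose f (x : V + U) : V + (U + W) :=
  match x with inl v => inl v | inr u => inr (inl u) end.
pose g (x : V + W) : V + (U + W) :=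
  match x with inl v => inl v | inr u => inr (inr u) end.
exists (U + W)%type, (map (atom_map f) s ++ map (atom_map g) r); split.
  by rewrite all_cat !atom_over_map sG.
have fE e h : join e h \o f = join e (h \o inl) by apply: funext => -[].
have gE e h : join e h \o g = join e (h \o inr) by apply: funext => -[].
move=> e; rewrite Ps Qr; split=> [[[u su] [w rw]]|[h]].
  exists (join u w); rewrite all_cat !atoms_hold_map fE gE.
  by apply/andP; split.
rewrite all_cat !atoms_hold_map fE gE => /andP[sh rh].
by split; [exists (h \o inl)|exists (h \o inr)].
Qed.

Lemma ppd_all Gamma V (I : eqType) (r : seq I) (P : I -> (V -> A) -> Prop) :
  (forall i, i \in r -> ppd Gamma (P i)) ->
  ppd Gamma (fun e => forall i, i \in r -> P i e).
Proof.
elim: r => [|i r IHr] Pr.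
  by apply: ppd_ext (ppd_true _ _) => e; split.
have rP j : j \in r -> ppd Gamma (P j).
  by move=> jr; apply: Pr; rewrite inE jr orbT.
apply: ppd_ext (ppd_and (Pr i (mem_head _ _)) (IHr rP)) => e.
split=> [[Pi Pe] j|Pe].
  by rewrite inE => /orP[/eqP->|/Pe].
by split=> [|j jr]; apply: Pe; rewrite inE ?eqxx ?jr ?orbT.
Qed.

Lemma ppd_ex Gamma V (U : finType) (P : (V + U -> A) -> Prop) :
  ppd Gamma P -> ppd Gamma (fun e => exists u, P (join e u)).
Proof.
move=> [W [s [sG Ps]]].
pose f (x : V + U + W) : V + (U + W) :=
  match x with
  | inl (inl v) => inl v | inl (inr u) => inr (inl u) | inr w => inr (inr w)
  end.
exists (U + W)%type, (map (atom_map f) s); split; first by rewrite atom_over_map.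
have fE e h : join e h \o f = join (join e (h \o inl)) (h \o inr).
  by apply: funext => -[[]|].
move=> e; split=> [[u /Ps[w sw]]|[h]].
  by exists (join u w); rewrite atoms_hold_map fE.
by rewrite atoms_hold_map fE => sh; exists (h \o inl); apply/Ps; exists (h \o inr).
Qed.

(** This is how parameters enter. The constants become existentially quantified variables indexed by
    [A] itself, and the atoms [AtConst] force their valuation to be [id]. *)
Lemma ppd_subst_const Gamma V W (g : V -> W + A) (P : (V -> A) -> Prop) :
  ppd Gamma P -> ppd Gamma (fun e => P (join e id \o g)).
Proof.
move=> PG.
have constG : ppd Gamma (fun e : W + A -> A =>
    forall a, a \in enum A -> e (inr a) = a).
  by apply: ppd_all => a _; apply: ppd_const.
apply: ppd_ext (ppd_ex (ppd_and constG (ppd_subst g PG))) => e.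
split=> [[u [uid Pu]]|Pe]; last by exists id.
by have <- : u = id by apply: funext => a; apply: uid; rewrite mem_enum.
Qed.

(** Since [W] is finite, [enum_rank] turns its elements into the numbered bound variables of a
    [pp_formula]. *)
Lemma ppd_pp_defines Gamma k (T : {set k.-tuple A}) :
  ppd Gamma (fun e : 'I_k -> A => mktuple e \in T) -> pp_defines Gamma T.
Proof.
move=> [W [s [sG Ts]]].
pose f (x : 'I_k + W) : 'I_k + 'I_#|W| :=
  match x with inl i => inl i | inr w => inr (enum_rank w) end.
exists (PPFormula (map (atom_map f) s)); split; first by rewrite atom_over_map.
apply/setP=> t; rewrite inE /pp_sat /=.
have {1}-> : t = mktuple (tnth t).
  by apply: eq_from_tnth => i; rewrite tnth_mktuple.
apply/idP/existsP => [/Ts[w sw]|[w]].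
  exists (mktuple (w \o enum_val)); rewrite atoms_hold_map.
  suff -> : valuation t (mktuple (w \o enum_val)) \o f = join (tnth t) w by [].
  by apply: funext => -[i|u] //=; rewrite tnth_mktuple /= enum_rankK.
rewrite atoms_hold_map => sw; apply/Ts; exists (tnth w \o enum_rank).
suff <- : valuation t w \o f = join (tnth t) (tnth w \o enum_rank) by [].
by apply: funext => -[].
Qed.

End PPDefinability.

(** * Ternary relations given by predicates, and strong functionality *)

Definition o0 : 'I_3 := @Ordinal 3 0 isT.
Definition o1 : 'I_3 := @Ordinal 3 1 isT.
Definition o2 : 'I_3 := @Ordinal 3 2 isT.

Lemma ord3_cases (i : 'I_3) : [\/ i = o0, i = o1 | i = o2].
Proof.
case: i => [[|[|[|//]]] lti]; [apply: Or31|apply: Or32|apply: Or33];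
  exact: val_inj.
Qed.

Section Ternary.
Variable A : finType.
Implicit Types (T : A -> A -> A -> Prop) (Gamma : {pred relation A}).

Definition set3 T : {set 3.-tuple A} :=
  [set t | `[<T (tnth t o0) (tnth t o1) (tnth t o2)>]].

Lemma in_set3 T t : t \in set3 T <-> T (tnth t o0) (tnth t o1) (tnth t o2).
Proof. by rewrite inE; split=> /asboolP. Qed.

Lemma mem_set3_ppd Gamma T :
  Rel (set3 T) \in Gamma ->
  ppd Gamma (fun e : 'I_3 -> A => T (e o0) (e o1) (e o2)).
Proof. by move/ppd_rel; apply: ppd_ext => e; rewrite in_set3 !tnth_mktuple. Qed.

Lemma set3_pp_defines Gamma T :
  ppd Gamma (fun e : 'I_3 -> A => T (e o0) (e o1) (e o2)) ->
  pp_defines Gamma (set3 T).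
Proof.
by move=> TG; apply: ppd_pp_defines; apply: ppd_ext TG => e;
  rewrite in_set3 !tnth_mktuple.
Qed.

(** The condition on a pair of coordinates is symmetric, so it suffices to treat [(o0, o1)],
    [(o0, o2)] and [(o1, o2)]. *)
Lemma set3_strongly_functional T :
  (forall x y, exists z, T x y z) -> (forall x z, exists y, T x y z) ->
  (forall y z, exists x, T x y z) ->
  (forall x y z z', T x y z -> T x y z' -> z = z') ->
  (forall x y y' z, T x y z -> T x y' z -> y = y') ->
  (forall x x' y z, T x y z -> T x' y z -> x = x') ->
  strongly_functional (set3 T).
Proof.
move=> ex2 ex1 ex0 inj2 inj1 inj0.
pose P (i j : 'I_3) := proj2 (set3 T) i j = [set: A * A] /\
  (forall s t, s \in set3 T -> t \in set3 T ->
     tnth s i = tnth t i -> tnth s j = tnth t j -> s = t).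
have proj2T i j : (forall x y, exists t, [/\ t \in set3 T, tnth t i = x &
    tnth t j = y]) -> proj2 (set3 T) i j = [set: A * A].
  move=> exT; apply/setP=> -[x y]; rewrite !inE; apply/imsetP.
  by have [t [tT <- <-]] := exT x y; exists t.
have symP i j : P i j -> P j i.
  move=> [Pij Tij]; split=> [|s t sT tT eqj eqi]; last exact: Tij eqi eqj.
  apply: proj2T => x y; have: (y, x) \in proj2 (set3 T) i j by rewrite Pij inE.
  by case/imsetP=> t tT [-> ->]; exists t.
have eqT (s t : 3.-tuple A) : tnth s o0 = tnth t o0 -> tnth s o1 = tnth t o1 ->
    tnth s o2 = tnth t o2 -> s = t.
  by move=> ? ? ?; apply: eq_from_tnth => k; case: (ord3_cases k) => ->.
have P01 : P o0 o1.
  split=> [|s t /in_set3 sT /in_set3 tT eq0 eq1].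
    apply: proj2T => x y; have [z xyz] := ex2 x y.
    by exists [tuple x; y; z]; split=> //; apply/in_set3.
  by apply: (eqT _ _ eq0 eq1); apply: inj2 sT _; rewrite eq0 eq1.
have P02 : P o0 o2.
  split=> [|s t /in_set3 sT /in_set3 tT eq0 eq2].
    apply: proj2T => x z; have [y xyz] := ex1 x z.
    by exists [tuple x; y; z]; split=> //; apply/in_set3.
  by apply: (eqT _ _ eq0 _ eq2); apply: inj1 sT _; rewrite eq0 eq2.
have P12 : P o1 o2.
  split=> [|s t /in_set3 sT /in_set3 tT eq1 eq2].
    apply: proj2T => y z; have [x xyz] := ex0 y z.
    by exists [tuple x; y; z]; split=> //; apply/in_set3.
  by apply: (eqT _ _ _ eq1 eq2); apply: inj0 sT _; rewrite eq1 eq2.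
move=> i j; suff: i <> j -> P i j by [].
by case: (ord3_cases i) => ->; case: (ord3_cases j) => -> // _; apply: symP.
Qed.

End Ternary.

Lemma strongly_functional_subdirect (A : finType) (T : {set 3.-tuple A}) :
  strongly_functional T -> subdirect T.
Proof.
move=> TF i; pose j := if i == o0 then o1 else o0.
have /TF[Tij _] : i <> j.
  by rewrite /j; case: (ord3_cases i) => ->.
apply/setP=> x; rewrite !inE; apply/imsetP.
have: (x, x) \in proj2 T i j by rewrite Tij inE.
by case/imsetP=> t tT [-> _]; exists t.
Qed.

Definition update (V : eqType) (A : Type) (e : V -> A) i c v :=
  if v == i then c else e v.

Lemma update_id (V : eqType) A (e : V -> A) i : update e i (e i) = e.
Proof. by apply: funext => v; rewrite /update; case: eqP => [->|]. Qed.

(** * Dichotomies for binary and ternary relations when alternative (1) fails *)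

Section NoBinary.
Variables (A : finType) (Gamma Delta : {pred relation A}).

(** The failure of alternative (1). [Delta] stands for a collection containing every strongly
    functional relation that [Gamma] pp-defines. *)
Hypothesis binary_full : forall B : {set 2.-tuple A},
  pp_defines Gamma B -> subdirect B -> irredundant B -> B = [set: 2.-tuple A].
Hypothesis strongly_functional_Delta : forall T : {set 3.-tuple A},
  strongly_functional T -> pp_defines Gamma T -> Rel T \in Delta.

Variables a0 a1 : A.
Hypothesis a01 : a0 <> a1.

(** If [Q] is not full, [binary_full] makes it redundant, so it is the graph of a bijection between
    its two coordinates, which gives uniqueness in both directions. *)
Lemma binary_dichotomy (V : eqType) (p q : V) (Q : A -> A -> Prop) :
  p <> q -> ppd Gamma (fun e : V -> A => Q (e p) (e q)) ->
  (forall x, exists y, Q x y) -> (forall y, exists x, Q x y) ->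
  (forall x y, Q x y) \/
  (forall x y y', Q x y -> Q x y' -> y = y') /\
  (forall x x' y, Q x y -> Q x' y -> x = x').
Proof.
move=> pq QG exr exl; apply: contrapT => /not_orP[nfull nbij].
pose i0 : 'I_2 := @Ordinal 2 0 isT; pose i1 : 'I_2 := @Ordinal 2 1 isT.
pose B : {set 2.-tuple A} := [set t | `[<Q (tnth t i0) (tnth t i1)>]].
have inB t : t \in B <-> Q (tnth t i0) (tnth t i1).
  by rewrite inE; split=> /asboolP.
have ord2 (i : 'I_2) : i = i0 \/ i = i1.
  by case: i => [[|[|//]] lti]; [left|right]; apply: val_inj.
have pairB x y : Q x y -> [tuple x; y] \in B by move=> Qxy; apply/inB.
have BG : pp_defines Gamma B.
  apply: ppd_pp_defines.
  apply: ppd_ext (ppd_subst (fun v => if v == p then i0 else i1) QG) => e.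
  by rewrite inB !tnth_mktuple /= eqxx; case: eqP => // /esym.
have Bsub : subdirect B.
  move=> i; apply/setP=> x; rewrite !inE; apply/imsetP.
  case: (ord2 i) => ->.
    by have [y /pairB xyB] := exr x; exists [tuple x; y].
  by have [y /pairB yxB] := exl x; exists [tuple y; x].
apply: nfull => x y; suff: [tuple x; y] \in B by move/inB.
(* What remains is irredundancy of [B]; a violation is a pair of coordinates, in either order,
   linked by a bijection [f]. *)
rewrite (binary_full BG Bsub) ?inE // => -[i [j [ij [f fbij Bf]]]]; apply: nbij.
have fB t : t \in B -> tnth t j = f (tnth t i).
  move=> tB; have: (tnth t i, tnth t j) \in proj2 B i j by apply: imset_f.
  by rewrite Bf => /imsetP[z _ [-> ->]].
have finj := bij_inj fbij.
case: (ord2 i) (ord2 j) ij fB => -> [] -> // _ fB.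
  have fQ u v : Q u v -> v = f u by move/pairB/fB.
  split=> [u v v' /fQ-> /fQ-> //|u u' v /fQ fv /fQ fv'].
  by apply: finj; rewrite -fv -fv'.
have fQ u v : Q u v -> u = f v by move/pairB/fB.
split=> [u v v' /fQ fv /fQ fv'|u u' v /fQ-> /fQ-> //].
by apply: finj; rewrite -fv -fv'.
Qed.

(** Each section [T x] is full or a bijection graph. If one section [T a] is full, then for every
    fixed [y] the relation between [x] and [z] contains [(a, a0)] and [(a, a1)]; not being
    functional, it is full, and so is [T]. *)
Lemma ternary_sections (V : eqType) (p q r : V) (T : A -> A -> A -> Prop) :
  p <> q -> p <> r -> q <> r ->
  ppd Gamma (fun e : V -> A => T (e p) (e q) (e r)) ->
  (forall x y, exists z, T x y z) -> (forall x z, exists y, T x y z) ->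
  (forall y z, exists x, T x y z) ->
  (forall x y z, T x y z) \/
  (forall x y z z', T x y z -> T x y z' -> z = z') /\
  (forall x y y' z, T x y z -> T x y' z -> y = y').
Proof.
move=> pq pr qr TG ex2 ex1 ex0.
have neqE (u v : V) : u <> v -> (u == v = false) * (v == u = false).
  by move=> uv; split; apply/eqP => // /esym.
have [[a Ta]|nfull] := pselect (exists a, forall y z, T a y z).
  left=> x y z.
  pose g (v : V) : V + A := if v == q then inr y else inl v.
  have TyG := ppd_subst_const g TG.
  have [|||//|[Tfun _]] := @binary_dichotomy V p r (fun x z => T x y z) pr.
  - by apply: ppd_ext TyG => e; rewrite /g /= eqxx !(neqE _ _ pq, neqE _ _ qr).
  - by move=> x'; apply: ex2.
  - by move=> z'; apply: ex0.
  - by case: a01; apply: Tfun (Ta y a0) (Ta y a1).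
right; suff Tx x : (forall y z z', T x y z -> T x y z' -> z = z') /\
    (forall y y' z, T x y z -> T x y' z -> y = y').
  by split=> x; case: (Tx x).
pose g (v : V) : V + A := if v == p then inr x else inl v.
have TxG := ppd_subst_const g TG.
have [|||full|//] := @binary_dichotomy V q r (T x) qr.
- by apply: ppd_ext TxG => e; rewrite /g /= eqxx !(neqE _ _ pq, neqE _ _ pr).
- by move=> y; apply: ex2.
- by move=> z; apply: ex1.
- by case: nfull; exists x.
Qed.

(** Sections at the first coordinate give uniqueness of [y] and [z]; exchanging the first two
    coordinates gives uniqueness of [x]. *)
Lemma ternary_dichotomy (T : A -> A -> A -> Prop) :
  ppd Gamma (fun e : 'I_3 -> A => T (e o0) (e o1) (e o2)) ->
  (forall x y, exists z, T x y z) -> (forall x z, exists y, T x y z) ->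
  (forall y z, exists x, T x y z) ->
  (forall x y z, T x y z) \/
  [/\ strongly_functional (set3 T), pp_defines Gamma (set3 T) &
      forall x y z z', T x y z -> T x y z' -> z = z'].
Proof.
move=> TG ex2 ex1 ex0.
have n01 : o0 <> o1 by [].
have n02 : o0 <> o2 by [].
have n12 : o1 <> o2 by [].
have [|[Tz Ty]] := ternary_sections n01 n02 n12 TG ex2 ex1 ex0; first by left.
have ex2' y x : exists z, T x y z by apply: ex2.
have [full|[_ Tx]] := @ternary_sections _ o1 o0 o2 (fun y x z => T x y z)
    (nesym n01) n12 n02 TG ex2' ex0 ex1.
  by left=> x y z; apply: full.
right; split=> //; last exact: set3_pp_defines.
by apply: set3_strongly_functional => // x x' y z; apply: Tx.
Qed.

(** * Definable relations [S(x, y)] are full or graphs of functions *)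

Section Graph.
Variable V : finType.
Implicit Types (S : (V -> A) -> A -> Prop) (L : seq V).

(** Fixing a coordinate leaves the type [V] of variables unchanged; the induction runs on the list
    [L] of coordinates that still matter. *)
Definition depends L S :=
  forall e e' y, {in L, e =1 e'} -> S e y -> S e' y.

(** The variable [None] carries the output [y], and [Some v] the input [v]. *)
Definition graph_ppd (G : {pred relation A}) S :=
  ppd G (fun e : option V -> A => S (e \o some) (e None)).

Lemma graph_ppd_fix S i c :
  graph_ppd Gamma S -> graph_ppd Gamma (fun e y => S (update e i c) y).
Proof.
move=> SG.
pose g v : option V + A :=
  if v is Some v' then (if v' == i then inr c else inl v) else inl None.
apply: ppd_ext (ppd_subst_const g SG) => e.
suff -> : (join e id \o g) \o some = update (e \o some) i c by [].
by apply: funext => v; rewrite /g /update /=; case: (v == i).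
Qed.

(** For [i] different from [j], this is the projection of [S] to the inputs [j] and [i], in this
    order, and the output. *)
Definition coord_proj S i j a b y :=
  exists e, S (update (update e i b) j a) y.

Lemma coord_proj_ppd S i j : graph_ppd Gamma S ->
  ppd Gamma (fun e : 'I_3 -> A => coord_proj S i j (e o0) (e o1) (e o2)).
Proof.
move=> SG.
pose g v : 'I_3 + V :=
  if v is Some v' then
    (if v' == j then inl o0 else if v' == i then inl o1 else inr v')
  else inl o2.
apply: ppd_ext (ppd_ex (ppd_subst g SG)) => e.
have gE w : (join e w \o g) \o some = update (update w i (e o1)) j (e o0).
  by apply: funext => v; rewrite /g /update /=; case: (v == j); case: (v == i).
by split=> -[w Sw]; exists w; move: Sw; rewrite /= gE.
Qed.

(* The relation [P] of the introduction, for the base point [c]. *)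
Definition transfer S i c v z u :=
  exists e, S (update e i z) u /\ S (update e i c) v.

Lemma transfer_ppd S i c : graph_ppd Gamma S ->
  ppd Gamma (fun e : 'I_3 -> A => transfer S i c (e o0) (e o1) (e o2)).
Proof.
move=> SG.
pose g v : 'I_3 + V :=
  if v is Some v' then (if v' == i then inl o1 else inr v') else inl o2.
pose h v : 'I_3 + V + A :=
  if v is Some v' then (if v' == i then inr c else inl (inr v'))
  else inl (inl o0).
apply: ppd_ext (ppd_ex (ppd_and (ppd_subst g SG) (ppd_subst_const h SG))) => e.
have gE w : (join e w \o g) \o some = update w i (e o1).
  by apply: funext => v; rewrite /g /update /=; case: (v == i).
have hE w : (join (join e w) id \o h) \o some = update w i c.
  by apply: funext => v; rewrite /h /update /=; case: (v == i).
by split=> -[w Sw]; exists w; move: Sw; rewrite /= gE hE.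
Qed.

Definition idx3 W (x y z : W) (k : 'I_3) : W :=
  if k == o0 then x else if k == o1 then y else z.

Lemma set3_Delta_ppd W (x y z : W) T :
  Rel (set3 T) \in Delta ->
  ppd Delta (fun e : W -> A => T (e x) (e y) (e z)).
Proof. by move/mem_set3_ppd/(ppd_subst (idx3 x y z)). Qed.

(** Induction on [L], splitting off its head [i]. The last hypothesis, that each input together with
    the output projects onto all pairs, is what makes the ternary dichotomy applicable. The relation
    [T] in the conclusion serves to show that the final list of ternary relations is nonempty. *)
Lemma graph_dichotomy L S :
  uniq L -> depends L S -> graph_ppd Gamma S ->
  (forall e, exists y, S e y) -> (forall y, exists e, S e y) ->
  (forall i, i \in L -> forall a y, exists2 e, e i = a & S e y) ->
  (forall e y, S e y) \/
  [/\ forall e y y', S e y -> S e y' -> y = y',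
      graph_ppd Delta S &
      exists2 T : {set 3.-tuple A},
        strongly_functional T & pp_defines Gamma T].
Proof.
elim: L S => [|i L IHL] S /=.
  (* With no relevant inputs, [S] does not depend on [e], so being onto makes it full. *)
  move=> _ Sdep _ _ onto _; left=> e y.
  by have [e' Se'] := onto y; apply: Sdep Se'.
move=> /andP[iL uL] Sdep SG tot onto onto_i.
have coordP e j y : S e y -> coord_proj S i j (e j) (e i) y.
  by move=> Sy; exists e; rewrite !update_id.
(* First case: inputs [i] and [j] already determine the output through a strongly functional
   relation. As [S] is total, it coincides with the graph given by that relation. *)
have [[j [jL [TF TG Tfun]]]|nT] := pselect (exists j, j \in L /\
    [/\ strongly_functional (set3 (coord_proj S i j)),
        pp_defines Gamma (set3 (coord_proj S i j)) &
        forall x y z z', coord_proj S i j x y z -> coord_proj S i j x y z' ->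
          z = z']).
  right; split; last by exists (set3 (coord_proj S i j)).
    by move=> e y y' /(coordP _ j)/Tfun eqy /(coordP _ j)/eqy.
  have TD := strongly_functional_Delta TF TG.
  apply: ppd_ext (set3_Delta_ppd (Some j) (Some i) None TD) => e.
  split=> [Te|/(coordP _ j)//].
  have [y Sy] := tot (e \o some).
  by rewrite (Tfun _ _ _ _ Te (coordP _ j _ Sy)).
(* Otherwise all these ternary projections are full, so the sections of [S] at [i] inherit the
   hypothesis on pairs needed for induction. *)
have full_coord j a b y : j \in L -> coord_proj S i j a b y.
  move=> jL; have ji : (i == j) = false.
    by apply/eqP=> ij; rewrite ij jL in iL.
  have [|||full|[TF TG Tfun]] := ternary_dichotomy (coord_proj_ppd i j SG).
  - move=> x z; pose e := update (update (fun _ => a) i z) j x.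
    by have [u Su] := tot e; exists u, (fun _ => a).
  - move=> x z; have [|e ej Se] := onto_i j _ x z; first by rewrite inE jL orbT.
    by exists (e i); rewrite -ej; apply: coordP.
  - move=> x z; have [|e ei Se] := onto_i i _ x z; first exact: mem_head.
    by exists (e j); rewrite -ei; apply: coordP.
  - exact: full.
  - by case: nT; exists j.
pose Sc c e y := S (update e i c) y.
have SE e y : S e y = Sc (e i) e y by rewrite /Sc update_id.
have Sc_dep c : depends L (Sc c).
  move=> e e' y ee'; apply: Sdep => k; rewrite inE /update.
  by case: (k == i) => //= /ee'.
have Sc_onto c y : exists e, Sc c e y.
  have [|e ei Se] := onto_i i _ c y; first exact: mem_head.
  by exists e; rewrite -ei -SE.
have Sc_tot c e : exists y, Sc c e y by apply: tot.
have Sc_onto_i c j : j \in L -> forall a y, exists2 e, e j = a & Sc c e y.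
  move=> jL a y; have [e Se] := full_coord j a c y jL.
  exists (update e j a); first by rewrite /update eqxx.
  suff eqe : update (update e j a) i c = update (update e i c) j a.
    by rewrite /Sc eqe.
  apply: funext => v; rewrite /update.
  by case: (v =P i) => // ->; case: eqP => // ij; rewrite ij jL in iL.
have IH c := IHL (Sc c) uL (Sc_dep c) (graph_ppd_fix i c SG) (Sc_tot c)
  (Sc_onto c) (Sc_onto_i c).
(* One full section makes [S] full: with the other inputs fixed, the relation between input [i] and
   the output relates [c] to both [a0] and [a1], hence is not functional. *)
have [[c fullc]|nfull] := pselect (exists c, forall e y, Sc c e y).
  left=> e y; rewrite SE.
  have BG : ppd Gamma (fun h : bool -> A => Sc (h true) e (h false)).
    pose g v : bool + A :=
      if v is Some v' then (if v' == i then inl true else inr (e v'))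
      else inl false.
    apply: ppd_ext (ppd_subst_const g SG) => h; rewrite /Sc.
    suff -> : (join h id \o g) \o some = update e i (h true) by [].
    by apply: funext => v; rewrite /g /update /=; case: (v == i).
  have tf : true <> false by [].
  have [||//|[Bfun _]] := @binary_dichotomy _ true false (Sc^~ e) tf BG.
  - by move=> x; apply: tot.
  - by move=> z; exists c; apply: fullc.
  - by case: a01; apply: Bfun (fullc e a0) (fullc e a1).
have {}IH c : [/\ forall e y y', Sc c e y -> Sc c e y' -> y = y',
    graph_ppd Delta (Sc c) &
    exists2 T : {set 3.-tuple A}, strongly_functional T & pp_defines Gamma T].
  by case: (IH c) => // fullc; case: nfull; exists c.
have Sfun e y y' : S e y -> S e y' -> y = y'.
  by rewrite !SE; case: (IH (e i)) => Sfun _ _; apply: Sfun.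
right; have [fun0 D0 exT] := IH a0; split=> //.
have transfer_of e u v : S e u -> Sc a0 e v -> transfer S i a0 v (e i) u.
  by move=> Su Sv; exists e; rewrite update_id.
have P_vz v z : exists u, transfer S i a0 v z u.
  have [e Se] := Sc_onto a0 v; have [u Su] := tot (update e i z).
  by exists u, e.
have P_zu z u : exists v, transfer S i a0 v z u.
  have [e Se] := Sc_onto z u; have [v Sv] := tot (update e i a0).
  by exists v, e.
(* At the base point [a0], both [u] and [v] are the value of the same functional section. *)
have P_a0 v u : transfer S i a0 v a0 u -> v = u.
  by case=> e [Su Sv]; apply: fun0 Sv Su.
have P_refl v : transfer S i a0 v a0 v.
  by have [e Se] := Sc_onto a0 v; exists e.
have PG := transfer_ppd i a0 SG.
(* The projection of [transfer] to [(v, u)] contains the diagonal (take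
   [z = a0]), so it is either the equality or everything. *)
have VG : ppd Gamma (fun h : bool -> A =>
    exists z, transfer S i a0 (h true) z (h false)).
  pose f (k : 'I_3) : bool + unit :=
    idx3 (inl true) (inr tt) (inl false) k.
  apply: ppd_ext (ppd_ex (ppd_subst f PG)) => h.
  by split=> [[z]|[z]]; [exists (z tt)|exists (fun _ => z)].
have tf : true <> false by [].
have [||P_vu|[Vfun _]] := @binary_dichotomy _ true false
  (fun v u => exists z, transfer S i a0 v z u) tf VG.
- by move=> v; exists v, a0.
- by move=> v; exists v, a0.
(* If the projection to [(v, u)] is everything, [transfer] is strongly functional, because fullness
   would give [a0 = a1] by [P_a0]. Then [S] is the composition of the section at [a0] with
   [transfer]: totality of [S] supplies a value, and [Tfun] shows it is the only one. *)
- have [full|[TF TG Tfun]] := ternary_dichotomy PG P_vz P_vu P_zu.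
    by case: a01; apply: P_a0.
  have TD := strongly_functional_Delta TF TG.
  pose g (v : option V) : option V + unit :=
    if v is Some v' then inl v else inr tt.
  have PD := set3_Delta_ppd (inr tt) (inl (Some i)) (inl None) TD.
  apply: ppd_ext (ppd_ex (ppd_and (ppd_subst g D0) PD)) => e /=.
  split=> [[w /= [S0 Pe]]|Se].
    have [u Su] := tot (e \o some).
    by rewrite (Tfun _ _ _ _ Pe (transfer_of _ _ _ Su S0)).
  have [v Sv] := tot (update (e \o some) i a0).
  by exists (fun _ => v); split=> //=; apply: (transfer_of (e \o some)).
(* If the projection is the equality, [S] does not depend on input [i] and coincides with its
   section at [a0]. *)
- apply: ppd_ext D0 => e; split=> [S0|Se].
    have [u Su] := tot (e \o some).
    suff -> : e None = u by [].
    apply: (Vfun (e None)); first by exists a0.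
    by exists (e (Some i)); apply: (transfer_of (e \o some)).
  have [v Sv] := tot (update (e \o some) i a0).
  suff -> : e None = v by [].
  apply: (Vfun v); last by exists a0.
  by exists (e (Some i)); apply: (transfer_of (e \o some)).
Qed.

End Graph.

End NoBinary.

(** * Choice of the ternary relations and reconstruction of [R] *)

Lemma finite_comprehension (T : finType) (P : T -> Prop) :
  exists s : seq T, forall x, x \in s <-> P x.
Proof.
exists (enum [pred x | `[<P x>]]) => x.
by rewrite mem_enum inE; split=> /asboolP.
Qed.

Theorem mainTheorem1 (A : finType) (n : nat) (hn : 1 <= n)
    (R : {set n.-tuple A})
    (hsub : subdirect R) (hirr : irredundant R) (hprop : proper_rel R) :
  (exists R' : {set 2.-tuple A},
      [/\ pp_defines (mem [:: Rel R]) R',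
          subdirect R', irredundant R' & proper_rel R'])
  \/
  (exists (m : nat) (Rs : m.-tuple {set 3.-tuple A}),
      [/\ 1 <= m,
          forall i, subdirect (tnth Rs i) /\ strongly_functional (tnth Rs i),
          pp_defines (mem [seq Rel T | T <- Rs]) R &
          forall i, pp_defines (mem [:: Rel R]) (tnth Rs i)]).
Proof.
have [bin|nbin] := pselect (exists R' : {set 2.-tuple A},
      [/\ pp_defines (mem [:: Rel R]) R',
          subdirect R', irredundant R' & proper_rel R']); first by left.
right; pose Gamma := mem [:: Rel R].
have binary_full (B : {set 2.-tuple A}) : pp_defines Gamma B -> subdirect B ->
    irredundant B -> B = [set: 2.-tuple A].
  by move=> BG Bsub Birr; apply: contrapT => Bprop; apply: nbin; exists B.
have RG : ppd Gamma (fun e : 'I_n -> A => mktuple e \in R).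
  by apply: ppd_rel; rewrite inE.
have tupleE (t : n.-tuple A) : mktuple (tnth t) = t.
  by apply: eq_from_tnth => i; rewrite tnth_mktuple.
have R_onto i a : exists2 t, t \in R & tnth t i = a.
  have: a \in proj R i by rewrite hsub inE.
  by case/imsetP=> t tR ->; exists t.
(* On a set with at most one element, a subdirect relation would be full. *)
have [a0 [a1 a01]] : exists a0 a1 : A, a0 <> a1.
  apply: contrapT => nA; apply: hprop; apply/setP=> t; rewrite inE.
  have [s sR _] := R_onto (Ordinal hn) (tnth t (Ordinal hn)).
  suff <- : s = t by [].
  apply: eq_from_tnth => i; apply: contrapT => neq.
  by apply: nA; exists (tnth s i), (tnth t i).
(* Binary projections of [R] are full, since a bijection graph would contradict irredundancy. *)
have R_pair i j a b : i <> j ->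
    exists t, [/\ t \in R, tnth t i = a & tnth t j = b].
  move=> ij; pose Q a b := exists t, [/\ t \in R, tnth t i = a & tnth t j = b].
  have QG : ppd Gamma (fun e : bool -> A => Q (e true) (e false)).
    pose g k : bool + 'I_n :=
      if k == i then inl true else if k == j then inl false else inr k.
    apply: ppd_ext (ppd_ex (ppd_subst g RG)) => e; split=> [[w wR]|[t [tR ti tj]]].
      exists (mktuple (join e w \o g)); split=> //; rewrite tnth_mktuple /= /g.
        by rewrite eqxx.
      by rewrite eqxx; case: eqP => // /esym.
    exists (tnth t); suff -> : join e (tnth t) \o g = tnth t by rewrite tupleE.
    by apply: funext => k; rewrite /g /=; do 2!case: eqP => [->|_] //.
  have tf : true <> false by [].
  have [x|y|full|[Qfun Qinj]] := binary_dichotomy binary_full tf QG.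
  - by have [t tR ti] := R_onto i x; exists (tnth t j), t.
  - by have [t tR tj] := R_onto j y; exists (tnth t i), t.
  - exact: full.
  case: hirr; exists i, j; split=> //.
  have Qtot x : exists y, Q x y.
    by have [t tR ti] := R_onto i x; exists (tnth t j), t.
  have [f fP] := choice Qtot.
  exists f.
    by apply: injF_bij => x y fxy; apply: Qinj (fP x) _; rewrite fxy.
  apply/setP=> -[x y]; apply/imsetP/imsetP=> [[t tR [-> ->]]|[x' _ [-> ->]]].
    by exists (tnth t i) => //; congr pair; apply: Qfun (fP _); exists t.
  by have [t [tR ti tj]] := fP x'; exists t => //; rewrite ti tj.
(* The list consists of all strongly functional ternary relations that [R] pp-defines. *)
have [Rs RsP] := finite_comprehension (fun T : {set 3.-tuple A} =>
  strongly_functional T /\ pp_defines Gamma T).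
pose Delta : {pred relation A} := mem [seq Rel T | T <- Rs].
have DeltaP (T : {set 3.-tuple A}) : strongly_functional T -> pp_defines Gamma T ->
    Rel T \in Delta.
  by move=> TF TG; apply: map_f; apply/RsP.
pose agree (I : {set 'I_n}) e (t : n.-tuple A) := forall i, i \in I -> tnth t i = e i.
pose full_on (I : {set 'I_n}) := forall e, exists2 t, t \in R & agree I e t.
(* The empty set qualifies because [R] is nonempty. *)
have [I /maxsetP[/asboolP Ifull Imax]] :
    {I : {set 'I_n} | maxset (fun I => `[<full_on I>]) I}.
  apply: ex_maxset; exists set0; apply/asboolP => e.
  have [t tR _] := R_onto (Ordinal hn) a0; by exists t => // i; rewrite inE.
pose S j e y := exists t, [/\ t \in R, agree I e t & tnth t j = y].
have S_graph j : j \notin I ->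
    [/\ forall e y y', S j e y -> S j e y' -> y = y',
      graph_ppd Delta (S j) &
      exists2 T : {set 3.-tuple A},
        strongly_functional T & pp_defines Gamma T].
  move=> jI.
  have SG : graph_ppd Gamma (S j).
    pose g k : option 'I_n + 'I_n :=
      if k == j then inl None else if k \in I then inl (Some k) else inr k.
    apply: ppd_ext (ppd_ex (ppd_subst g RG)) => e.
    split=> [[w wR]|[t [tR tI tj]]].
      exists (mktuple (join e w \o g)); split=> // [i iI|].
        rewrite tnth_mktuple /= /g iI; case: eqP => // ij.
        by rewrite -ij iI in jI.
      by rewrite tnth_mktuple /= /g eqxx.
    exists (tnth t); suff -> : join e (tnth t) \o g = tnth t by rewrite tupleE.
    apply: funext => k; rewrite /g /=; case: eqP => [->//|_].
    by case: ifP => // /tI.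
  have Sdep : depends (enum I) (S j).
    move=> e e' y ee' [t [tR tI tj]]; exists t; split=> // i iI.
    by rewrite tI // ee' // mem_enum.
  have [|y|i|full|//] :=
      graph_dichotomy binary_full DeltaP a01 (enum_uniq I) Sdep SG.
  - by move=> e; have [t tR tI] := Ifull e; exists (tnth t j), t.
  - by have [t tR tj] := R_onto j y; exists (tnth t), t.
  - rewrite mem_enum => iI a y.
    have [|t [tR ti tj]] := R_pair i j a y.
      by move=> ij; rewrite -ij iI in jI.
    by exists (tnth t) => //; exists t.
  (* Fullness of [S j] would let [j] be added to [I], against maximality. *)
  have jfull : full_on (j |: I).
    move=> e; have [t [tR tI tj]] := full e (e j); exists t => // i.
    by rewrite !inE => /predU1P[->//|/tI].
  have := Imax _ (asboolT jfull) (subsetUr _ _).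
  by move=> IE; rewrite -IE setU11 in jI.
(* Properness of [R] provides a coordinate outside [I]; its graph yields a member of [Rs]. *)
have [j jI] : exists j, j \notin I.
  apply: contrapT => nI; apply: hprop; apply/setP=> t; rewrite inE.
  have [s sR sI] := Ifull (tnth t).
  suff <- : s = t by [].
  apply: eq_from_tnth => i; apply: sI.
  by apply: contrapT => /negP iI; apply: nI; exists i.
exists (size Rs), (in_tuple Rs); split.
- have [_ _ [T TF TG]] := S_graph j jI.
  have : T \in Rs by apply/RsP.
  by case: (Rs).
- move=> i; have /RsP[TF _] : tnth (in_tuple Rs) i \in Rs := mem_tnth _ _.
  by split=> //; apply: strongly_functional_subdirect.
- apply: ppd_pp_defines.
  (* The tuple [e] lies in [R] exactly when every [e j] with [j] outside [I] is the value of [S j]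
     at [e]: some [t] in [R] agrees with [e] on [I], and functionality then forces agreement
     elsewhere. *)
  have SD : ppd Delta (fun e : 'I_n -> A =>
      forall j, j \in enum (~: I) -> S j e (e j)).
    apply: ppd_all => k; rewrite mem_enum inE => kI.
    have [_ kD _] := S_graph k kI.
    exact: (ppd_subst (fun v => if v is Some v' then v' else k) kD).
  apply: ppd_ext SD => e; split=> [Se|eR k _].
    have [t tR tI] := Ifull e.
    suff -> : mktuple e = t by [].
    apply: eq_from_tnth => k; rewrite tnth_mktuple.
    have [/tI//|kI] := boolP (k \in I).
    have [kfun _ _] := S_graph k kI.
    apply: (kfun e); last by exists t.
    by apply: Se; rewrite mem_enum inE.
  by exists (mktuple e); split=> // [i _|]; rewrite tnth_mktuple.
- by move=> i; have /RsP[] : tnth (in_tuple Rs) i \in Rs := mem_tnth _ _.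
Qed.
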